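(* Let $d$ be a positive integer. The typical function $f\in C([0,1]^d)$ satisfies $\operatorname{lip} f(x)=0$ at points of a residual set of full measure in $[0,1]^d$. That is, the set of those $f\in C([0,1]^d)$ for which there is a residual set $R\subset[0,1]^d$ of full $d$-dimensional Lebesgue measure in $[0,1]^d$ with $\operatorname{lip} f(x)=0$ for all $x\in R$ has meager complement in $C([0,1]^d)$.
   Context: $C([0,1]^d)$ is the space of real-valued continuous functions on $[0,1]^d$ with the supremum norm. A set in a complete metric space is meager if it is a countable union of nowhere dense sets, and residual if its complement is meager. A property is typical in a complete metric space $X$ if the set of $x\in X$ not having the property is meager. For $f\in C([0,1]^d)$ and $x\in[0,1]^d$, $$\operatorname{lip} f(x)=\liminf_{r\to 0^+}\ \sup_{y\in[0,1]^d,\ |x-y|\le r}\frac{|f(y)-f(x)|}{r}\in[0,\infty],$$ where $|\cdot|$ is a norm on $\mathbb{R}^d$, say the maximum norm (the condition $\operatorname{lip} f(x)=0$ does not depend on the choice of norm). *)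

(* Defs.v *)
From HB Require Import structures.
From mathcomp Require Import all_boot all_order all_algebra.
From mathcomp Require Import all_classical all_reals all_analysis.

Set Implicit Arguments.
Unset Strict Implicit.
Unset Printing Implicit Defensive.

Import Order.TTheory GRing.Theory Num.Theory.
Import numFieldNormedType.Exports.

Local Open Scope classical_set_scope.
Local Open Scope ring_scope.

Section category.
Context {T : topologicalType}.
Implicit Types A : set T.

Definition nowhere_dense A := interior (closure A) = set0.

Definition meager A := exists2 F : (set T)^nat,
  forall n, nowhere_dense (F n) & A = \bigcup_n F n.

Definition residual A := meager (~` A).

Definition typical (P : T -> Prop) := meager [set x | ~ P x].

End category.

(* As a type, [cube R d] carries the subspace topology of 'rV[R]_d, whose
   norm is the maximum norm. *)
Definition cube (R : realType) (d : nat) : set 'rV[R]_d :=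
  [set x | forall i, 0 <= x ord0 i <= 1].
Arguments cube : clear implicits.

(* An alias, so that the only topology in scope is that of the metric below. *)
Definition Ccube (R : realType) (d : nat) : Type :=
  continuousType (cube R d) R.

Section supremum_metric.
Context {R : realType} {d : nat}.
Implicit Types f g h : Ccube R d.

Definition Cval f : cube R d -> R := f.

Definition supdist f g : R := sup [set `|Cval f x - Cval g x| | x in setT].

Lemma cube0 : cube R d 0.
Proof. by move=> i; rewrite mxE lexx ler01. Qed.

Definition cube_origin : cube R d :=
  exist (fun x => x \in cube R d) 0 (mem_set cube0).

Lemma cube_compact : compact (cube R d).
Proof.
have -> : cube R d = [set v | forall i, `[0, 1]%classic (v ord0 i)].
  by apply/seteqP; split => v /= + i => /(_ i); rewrite in_itv.
apply: (@rV_compact R d (fun=> `[0, 1]%classic)) => i.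
exact: segment_compact.
Qed.

Lemma Ccube_bounded f : exists M, forall x, `|Cval f x| <= M.
Proof.
have cf : {within cube R d, continuous (valL_ 0 (Cval f))}.
  exact: (@subspace_valL_continuousP' _ (cube R d) _ 0 f).2 (@cts_fun _ _ f).
have [M [_ fM]] := compact_bounded (continuous_compact cf cube_compact).
exists (M + 1) => x; apply: (fM (M + 1)); first by rewrite ltrDl.
exists (\val x); first exact: set_valP.
by rewrite -[in RHS](valLK 0 (Cval f)).
Qed.

Lemma supdist_has_sup f g : has_sup [set `|Cval f x - Cval g x| | x in setT].
Proof.
split.
  by exists `|Cval f cube_origin - Cval g cube_origin|, cube_origin.
have [M fM] := Ccube_bounded f; have [N gN] := Ccube_bounded g.
exists (M + N) => _ [x _ <-].
by rewrite (le_trans (ler_normB _ _))// lerD.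
Qed.

Lemma supdist_ge f g x : `|Cval f x - Cval g x| <= supdist f g.
Proof. by apply: (sup_upper_bound (supdist_has_sup f g)); exists x. Qed.

Lemma supdist_le f g (M : R) :
  (forall x, `|Cval f x - Cval g x| <= M) -> supdist f g <= M.
Proof.
move=> fgM; apply: ge_sup; first by have [] := supdist_has_sup f g.
by move=> _ [x _ <-].
Qed.

Lemma supdistxx f : supdist f f = 0.
Proof.
apply/eqP; rewrite eq_le; apply/andP; split.
  by apply: supdist_le => x; rewrite subrr normr0.
exact: le_trans (normr_ge0 _) (supdist_ge f f cube_origin).
Qed.

Lemma supdist_positivity f g : supdist f g = 0 -> f = g.
Proof.
move=> fg0; apply/continuousEP => x; apply/eqP.
by rewrite -subr_eq0 -normr_le0 -fg0 supdist_ge.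
Qed.

Lemma supdist_sym f g : supdist f g = supdist g f.
Proof.
by congr sup; apply: eq_imagel => x _; rewrite distrC.
Qed.

Lemma supdist_triangle g f h : supdist f h <= supdist f g + supdist g h.
Proof.
apply: supdist_le => x.
by rewrite (le_trans (ler_distD (Cval g x) _ _))// lerD// supdist_ge.
Qed.

HB.instance Definition _ := Choice.on (Ccube R d).
HB.instance Definition _ := @isMetric.Build R (Ccube R d)
  supdist supdistxx supdist_positivity supdist_sym supdist_triangle.

End supremum_metric.

Section little_lip.
Context {R : realType} {d : nat}.

Definition lip (f : Ccube R d) (x : cube R d) : \bar R :=
  limf_einf
    (fun r : R => ereal_sup
      [set (`|Cval f y - Cval f x| / r)%:E
         | y in [set y : cube R d | `|\val x - \val y| <= r]])
    0^'+.

End little_lip.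

Section lebesgue.
Context {R : realType} {d : nat}.
Implicit Types a b : 'rV[R]_d.

Definition box a b : set 'rV[R]_d :=
  [set x | forall i, a ord0 i <= x ord0 i <= b ord0 i].

Definition vol a b : R := \prod_(i < d) (b ord0 i - a ord0 i).

(* d-dimensional Lebesgue outer measure: Lebesgue measure is its restriction
   to the Lebesgue measurable sets, and the sets of Lebesgue measure zero are
   exactly those of outer measure zero. *)
Definition lebesgue_outer (A : set 'rV[R]_d) : \bar R :=
  ereal_inf [set s | exists a b : nat -> 'rV[R]_d,
    [/\ forall k i, a k ord0 i <= b k ord0 i,
        A `<=` \bigcup_k box (a k) (b k) &
        s = (\sum_(k <oo) (vol (a k) (b k))%:E)%E]].

Definition full_measure (A : set (cube R d)) :=
  lebesgue_outer (cube R d `\` (\val @` A)) = 0%E.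

End lebesgue.

(* Main.v *)
Require Import Defs.
From mathcomp Require Import all_boot all_order all_algebra.
From mathcomp Require Import all_classical all_reals all_analysis.
From mathcomp Require Import lra ring.
Import Order.TTheory GRing.Theory Num.Theory.
Import numFieldNormedType.Exports.

(** Every continuous [f] is uniformly close to a function that is constant near
    most points of the cube.  Let [psi] be a staircase on [0, 1] with [N] steps:
    it climbs from [k / N] to [(k + 1) / N] on the short interval from [k / N]
    to [k / N + r] and is constant in between.  It stays within [1 / N] of the
    identity, so [g x = f (psi x_1, ..., psi x_d)] is close to [f] by uniform
    continuity.  Moreover [g] is constant on the ball of radius [r] around [x]
    as soon as no coordinate of [x] lies within [r] of a climb; such points form
    an open set, [tread N r], whose complement is covered by [d * N] slabs of
    volume [3 * r] each.  First [N] and then [r] are at our disposal, so the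
    tread can be made as dense and as close to full measure as we like
    ([exists_terraced], [near_tread], [vol_slabs]).

    At stage [n] consider the [f] that are closer than [r / (2 * (n + 1))] to
    such a [g], for some [N] and [r] which are fine enough for [n].  They form an
    open dense set.  For [f] in it and [x] in the tread of [g], the oscillation
    of [f] at [x] on scale [r <= 1 / (n + 1)] is at most [r / (n + 1)]
    ([nearly_terraced_osc]).

    The typical [f] belongs to all of these open dense sets.  If [x] lies in the
    treads of infinitely many stages, then the oscillation quotient at [x] is at
    most [1 / (n + 1)] at scales tending to zero, so [lip f x = 0].  The set of
    such [x] is the limsup of the treads: it is residual, since from every stage
    on the treads are open with dense union, and its complement is covered, for
    every [m], by the slabs of the stages from [m] on, whose total volume is at
    most [1 / 2 ^ m]. *)

Set Implicit Arguments.
Unset Strict Implicit.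
Unset Printing Implicit Defensive.

Local Open Scope classical_set_scope.
Local Open Scope ring_scope.

(** * Residual sets *)

Section category.
Context {T : topologicalType}.
Implicit Types A : set T.

Lemma open_dense_nowhere_dense (U : set T) :
  open U -> dense U -> nowhere_dense (~` U).
Proof.
move=> oU dU; rewrite /nowhere_dense closure_setC interiorC.
rewrite (interior_id U).1// -subset0 => x; apply; move=> B.
rewrite nbhsE => -[V [oV Vx] VB].
have [y [Vy Uy]] := dU V (ex_intro _ x Vx) oV.
by exists y; split; last exact: VB.
Qed.

Lemma nowhere_dense_subset A B : A `<=` B -> nowhere_dense B -> nowhere_dense A.
Proof.
move=> AB B0; rewrite /nowhere_dense -subset0 -B0.
exact/interiorS/closure_subset.
Qed.

(** With [T] a space of functions and [A x] the property [P x], this is also the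
    way to prove that [P] is typical. *)
Lemma residual_bigcap_open_dense (U : (set T)^nat) A :
  (forall n, open (U n)) -> (forall n, dense (U n)) ->
  \bigcap_n U n `<=` A -> residual A.
Proof.
move=> oU dU UA; exists (fun n => ~` A `\` U n) => [n|].
  apply: nowhere_dense_subset (open_dense_nowhere_dense (oU n) (dU n)).
  by move=> x [].
apply/seteqP; split=> [x Ax|x [n _ []]//].
apply: contrapT => nx; apply/Ax/UA => n _.
by apply: contrapT => nU; apply: nx; exists n.
Qed.

Lemma residual_limsup_open (G : (set T)^nat) :
  (forall n, open (G n)) -> (forall m, dense (\bigcup_(n >= m) G n)) ->
  residual (\bigcap_m \bigcup_(n >= m) G n).
Proof.
move=> oG dG.
apply: (@residual_bigcap_open_dense (fun m => \bigcup_(n >= m) G n)) => // m.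
exact: bigcup_open.
Qed.

End category.

(** * Null sets for the Lebesgue outer measure *)

Section outer_measure.
Context {R : realType} {d : nat}.
Implicit Types (p : 'rV[R]_d * 'rV[R]_d) (s : seq ('rV[R]_d * 'rV[R]_d)).

Lemma vol_ge0 (a b : 'rV[R]_d) :
  (forall i, a ord0 i <= b ord0 i) -> 0 <= vol a b.
Proof. by move=> ab; apply: prodr_ge0 => i _; rewrite subr_ge0. Qed.

Lemma lebesgue_outer_ge0 (A : set 'rV[R]_d) : (0 <= lebesgue_outer A)%E.
Proof.
apply: le_ereal_inf_tmp => _ [a [b [ab _ ->]]].
by apply: nneseries_ge0 => k _ _; rewrite lee_fin vol_ge0.
Qed.

(** The definition of the outer measure asks for a single sequence of boxes; a
    bijection of [nat * nat] with [nat] rearranges the double sequence, which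
    preserves a sum of nonnegative terms. *)
Lemma lebesgue_outer_le_double_series (A : set 'rV[R]_d)
    (a b : nat -> nat -> 'rV[R]_d) :
  (forall n k i, a n k ord0 i <= b n k ord0 i) ->
  A `<=` \bigcup_n \bigcup_k box (a n k) (b n k) ->
  (lebesgue_outer A <= \sum_(n <oo) \sum_(k <oo) (vol (a n k) (b n k))%:E)%E.
Proof.
move=> ab Aab.
have vol0 n k : (0 <= (vol (a n k) (b n k))%:E)%E by rewrite lee_fin vol_ge0.
have /card_esym/ppcard_eqP[f] := card_nat2.
apply: ereal_inf_lbound.
exists (fun k => a (f k).1 (f k).2), (fun k => b (f k).1 (f k).2).
split.
- by move=> k i; exact: ab.
- move=> x /Aab[n _ [k _ xnk]]; exists (f^-1%FUN (n, k)) => //.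
  by rewrite invK ?inE.
rewrite [RHS]nneseries_esumT//.
rewrite nneseries_esumT; last by move=> n; apply: nneseries_ge0 => k _ _.
under eq_esum do rewrite nneseries_esumT//.
rewrite esum_esum//.
rewrite (_ : setT `*`` _ = [set: nat * nat]); last by apply/seteqP.
by rewrite (@reindex_esum _ _ _ [set: nat] [set: nat * nat] f).
Qed.

(** The finite lists are padded to infinite sequences by one-point boxes, which
    have volume zero because [d] is positive. *)
Lemma lebesgue_outer_le_boxes (d_gt0 : (0 < d)%N) (A : set 'rV[R]_d)
    (s : nat -> seq ('rV[R]_d * 'rV[R]_d)) :
  (forall n p, p \in s n -> forall i, p.1 ord0 i <= p.2 ord0 i) ->
  (forall x, A x -> exists n, exists2 p, p \in s n & box p.1 p.2 x) ->
  (lebesgue_outer A <= \sum_(n <oo) (\sum_(p <- s n) vol p.1 p.2)%:E)%E.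
Proof.
move=> s_le As; pose p0 : 'rV[R]_d * 'rV[R]_d := (0, 0).
have le_nth n k i : (nth p0 (s n) k).1 ord0 i <= (nth p0 (s n) k).2 ord0 i.
  have [ks|ks] := ltnP k (size (s n)); first exact/s_le/mem_nth.
  by rewrite nth_default.
apply: le_trans (lebesgue_outer_le_double_series le_nth _) _.
  move=> x /As[n [p ps xp]]; exists n => //; exists (index p (s n)) => //.
  by rewrite nth_index.
apply: lee_nneseries => [n _ _|n _].
  by apply: nneseries_ge0 => k _ _; rewrite lee_fin vol_ge0.
rewrite (nneseries_split 0%N (size (s n))); last first.
  by move=> k _; rewrite lee_fin vol_ge0.
rewrite eseries0 ?adde0 ?add0n; last first.
  move=> k ks _; rewrite nth_default// /vol (bigD1 (Ordinal d_gt0))//=.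
  by rewrite subrr mul0r.
by rewrite [in leRHS](big_nth p0) sumEFin.
Qed.

End outer_measure.

(** * The cube and uniform continuity *)

Section cube_metric.
Context {R : realType} {d : nat}.
Implicit Types (u v : 'rV[R]_d) (x y : cube R d).

Lemma row_norm_leP u (r : R) : 0 <= r ->
  reflect (forall i, `|u ord0 i| <= r) (`|u| <= r).
Proof.
move=> r0; apply: (iffP idP) => [ur i|ur].
  apply: le_trans ur; rewrite [leRHS]/Num.norm/= mx_normrE.
  by apply/bigmax_geP; right; exists (ord0, i).
rewrite [leLHS]/Num.norm/= mx_normrE; apply/bigmax_leP; split => // -[i j] _ /=.
by rewrite ord1.
Qed.

Lemma cube_le x i : 0 <= \val x ord0 i <= 1.
Proof. exact: (set_valP x) i. Qed.

Lemma cube_ballP x (e : R) y : ball x e y <-> `|\val x - \val y| < e.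
Proof. by rewrite -initial_ballE/= -ball_normE. Qed.

Definition to_cube u (hu : cube R d u) : cube R d :=
  exist (fun v => v \in cube R d) u (mem_set hu).

(** Heine's theorem, from the near-covering form of compactness. *)
Lemma Ccube_unif_continuous (f : Ccube R d) (e : R) : 0 < e ->
  exists2 r : R, 0 < r &
    forall x y, `|\val x - \val y| <= r -> `|Cval f x - Cval f y| < e.
Proof.
move=> e0.
pose P (r : R) u := forall x y, \val x = u ->
  `|u - \val y| <= r -> `|Cval f x - Cval f y| < e.
suff : \forall r \near 0^'+, cube R d `<=` P r.
  move=> H; have : \forall r \near (0:R)^'+, 0 < r /\ cube R d `<=` P r.
    by apply: filterI => //; exact: nbhs_right_gt.
  move=> /filter_ex[r [r0 rP]]; exists r => // x y xy.
  by apply: (rP (\val x)) => //; exact: set_valP.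
have /compact_near_coveringP/near_covering_withinP H :=
  cube_compact (R := R) (d := d).
apply: H => u hu; have e2 : 0 < e / 2 by rewrite divr_gt0.
have : \forall y \near to_cube hu, `|Cval f (to_cube hu) - Cval f y| < e / 2.
  by have /cvgrPdist_lt := @cts_fun _ _ f (to_cube hu); exact.
move=> /nbhs_ballP[r /= r0 rf].
have r2 : 0 < r / 2 by rewrite divr_gt0.
exists (ball u (r / 2), [set t | t < r / 2]).
  by split; [exact: nbhsx_ballx|exact: nbhs_right_lt].
move=> [v t] [/= uv tr] hv x y xv vy.
have fx : `|Cval f (to_cube hu) - Cval f x| < e / 2.
  apply: rf; apply/cube_ballP; rewrite xv /=.
  by move: uv; rewrite -ball_normE/= => /lt_trans; apply; lra.
have fy : `|Cval f (to_cube hu) - Cval f y| < e / 2.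
  apply: rf; apply/cube_ballP => /=.
  apply: le_lt_trans (ler_distD v _ _) _.
  by move: uv; rewrite -ball_normE/=; lra.
by move: fx fy; rewrite !ltr_norml; lra.
Qed.

(** Stated with a Lipschitz condition on [phi], because this avoids all reasoning
    on the topology of the cube: uniform continuity of [f] is enough. *)
Lemma Lipschitz_comp_continuous (f : Ccube R d) (phi : cube R d -> cube R d)
    (L : R) :
  0 < L ->
  (forall x y, `|\val (phi x) - \val (phi y)| <= L * `|\val x - \val y|) ->
  continuous (Cval f \o phi : cube R d -> R).
Proof.
move=> L0 phiL x; apply/(cvgrPdist_lt (FF := nbhs_filter x)) => e e0.
have [r r0 fr] := Ccube_unif_continuous f e0.
apply/nbhs_ballP; exists (r / L) => /= [|y]; first by rewrite divr_gt0.
move=> /cube_ballP xy; apply: fr; apply: le_trans (phiL x y) _.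
by rewrite mulrC -ler_pdivlMr// ltW.
Qed.

End cube_metric.

(** * Staircase functions on the unit interval *)

Section staircase.
Context {R : realType}.
Implicit Types (a r t : R) (N k : nat).

Definition ramp r a t : R := Num.min 1 (Num.max 0 ((t - a) / r)).

(** Up to the factor [1 / N], one unit ramp is added at each [k / N]; written as
    a sum, the function needs no case distinction on the step containing [t]. *)
Definition staircase N r t : R := (\sum_(k < N) ramp r (k%:R / N%:R) t) / N%:R.

Lemma ramp_lo r a t : 0 < r -> t <= a -> ramp r a t = 0.
Proof.
move=> r0 ta; rewrite /ramp (max_idPl _) ?(min_idPr _)//.
by rewrite ler_pdivrMr// mul0r subr_le0.
Qed.

Lemma ramp_hi r a t : 0 < r -> a + r <= t -> ramp r a t = 1.
Proof.
move=> r0 art; rewrite /ramp (min_idPl _)// le_max ler_pdivlMr// mul1r.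
by rewrite lerBrDl art orbT.
Qed.

Lemma ramp01 r a t : 0 <= ramp r a t <= 1.
Proof. by rewrite /ramp le_min ler01 le_max lexx ge_min lexx. Qed.

Lemma ramp_Lipschitz r a t s : 0 < r ->
  `|ramp r a t - ramp r a s| <= r^-1 * `|t - s|.
Proof.
move=> r0; have -> : r^-1 * `|t - s| = `|(t - a) / r - (s - a) / r|.
  rewrite -mulrBl normrM (gtr0_norm (_ : 0 < r^-1)) ?invr_gt0// mulrC.
  by congr (`|_| * _); ring.
rewrite /ramp; move: ((t - a) / r) ((s - a) / r) => p q.
rewrite !minEle !maxEle.
case: (leP 0 p) => p0; case: (leP 0 q) => q0; rewrite ?ler10;
  case: (leP 1 p) => p1; case: (leP 1 q) => q1; rewrite ler_norml;
  case: (ler0P (p - q)) => pq; apply/andP; split; lra.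
Qed.

(** The [N] ramps are [r^-1]-Lipschitz and the sum is divided by [N]. *)
Lemma staircase_Lipschitz N r t s : (0 < N)%N -> 0 < r ->
  `|staircase N r t - staircase N r s| <= r^-1 * `|t - s|.
Proof.
move=> N0 r0; have NR : 0 < N%:R :> R by rewrite ltr0n.
rewrite /staircase -mulrBl -sumrB normrM.
rewrite (gtr0_norm (_ : 0 < N%:R^-1)) ?invr_gt0//.
rewrite ler_pdivrMr//; apply: le_trans (ler_norm_sum _ _ _) _.
apply: (@le_trans _ _ (\sum_(k < N) r^-1 * `|t - s|)).
  by apply: ler_sum => k _; exact: ramp_Lipschitz.
by rewrite sumr_const card_ord mulr_natr.
Qed.

(** By induction on the number of ramps: as long as [t] is beyond the first [n]
    ramps they add up to [n / N], and the ramps beyond [t] contribute nothing. *)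
Lemma staircase_dist N r t : (0 < N)%N -> 0 < r -> r <= N%:R^-1 -> 0 <= t <= 1 ->
  t <= staircase N r t <= Num.min 1 (t + N%:R^-1).
Proof.
move=> N0 r0 rN t01; have NR : 0 < N%:R :> R by rewrite ltr0n.
pose S n := (\sum_(k < n) ramp r (k%:R / N%:R) t) / N%:R.
suff H n : Num.min t (n%:R / N%:R) <= S n <= Num.min (t + N%:R^-1) (n%:R / N%:R).
  have := H N; rewrite divff ?gt_eqF// -/(staircase N r t) (min_idPl _) 1?minC//.
  by have /andP[] := t01.
elim: n => [|n IHn].
  rewrite /S big_ord0 mul0r; case/andP: t01 => t0 _.
  by rewrite ge_min le_min lexx orbT addr_ge0// invr_ge0 ltW.
rewrite /S big_ord_recr/= mulrDl -/(S n).
set c := ramp _ _ _; have SE : n.+1%:R / N%:R = n%:R / N%:R + N%:R^-1 :> R.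
  by rewrite -natr1 mulrDl mul1r.
rewrite SE; set a := n%:R / N%:R in c *; have := IHn.
rewrite -/a !ge_min !le_min => /andP[/orP Sl /andP[S1 S2]].
have /andP[c0 c1] : 0 <= c / N%:R <= N%:R^-1.
  have /andP[? ?] := ramp01 r a t.
  by rewrite divr_ge0 ?(ltW NR)//= ler_pdivrMr// mulVf ?gt_eqF.
have N'0 : 0 < N%:R^-1 :> R by rewrite invr_gt0.
(* Below the new ramp nothing changes; beyond its foot [a] the previous ramps
   are complete, so that the partial sum is exactly [a]. *)
have [ta|a_t] := leP t a.
  rewrite (_ : c = 0) ?mul0r ?addr0 ?S1//; last exact: ramp_lo.
  by apply/andP; split; [apply/orP; left; case: Sl; lra|lra].
have Sa : S n = a by apply/eqP; rewrite eq_le S2 /=; case: Sl; lra.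
rewrite Sa; apply/andP; split; last by apply/andP; split; lra.
have [art|art] := leP (a + r) t.
  by rewrite /c ramp_hi// mul1r lexx orbT.
apply/orP; left.
(* A ramp of slope [1 / r >= N] rises at least as fast as [N * (t - a)]. *)
suff : t - a <= c / N%:R by lra.
rewrite /c /ramp (max_idPr _) ?(min_idPr _); last 2 first.
- by rewrite ler_pdivrMr//; lra.
- by rewrite divr_ge0 ?(ltW r0)//; lra.
rewrite -mulrA ler_peMr//; first by lra.
by rewrite ler_pdivlMl ?mulr1.
Qed.

(** Each ramp takes the same value, 0 or 1, at [t] and at [s]: the margin [r] on
    either side of the climb, which has width [r] itself, absorbs the move from
    [t] to [s]. *)
Lemma staircase_flat N r t s : 0 < r ->
  (forall k, (k < N)%N -> t < k%:R / N%:R - r \/ k%:R / N%:R + 2 * r < t) ->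
  `|t - s| <= r -> staircase N r t = staircase N r s.
Proof.
move=> r0 tN ts; congr (_ / _); apply: eq_bigr => k _.
move: ts; rewrite ler_norml => ts.
by case: (tN k (ltn_ord k)) => ?; [rewrite !ramp_lo|rewrite !ramp_hi] => //; lra.
Qed.

(** The midpoint of the step containing [t] is at distance [1 / (2 * N)] from the
    nearest [k / N], hence more than [2 * r] away from it. *)
Lemma flat_point_near N r t :
  (0 < N)%N -> 0 < r -> 4 * r * N%:R < 1 -> 0 <= t <= 1 ->
  exists s : R, [/\ 0 <= s <= 1, `|t - s| <= N%:R^-1 &
    forall k, (k < N)%N -> s < k%:R / N%:R - r \/ k%:R / N%:R + 2 * r < s].
Proof.
move=> N0 r0 rN /andP[t0 t1]; have NR : 0 < N%:R :> R by rewrite ltr0n.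
have [m mN /andP[mt tm]] : exists2 m, (m < N)%N & m%:R <= t * N%:R <= m.+1%:R.
  have tN0 : 0 <= t * N%:R by rewrite mulr_ge0 // ltW.
  have /andP[l u] := truncn_itv tN0; set m := Num.trunc _ in l u.
  have [mN|Nm] := ltnP m N; first by exists m => //; rewrite l ltW.
  (* Only [t = 1] reaches the index [N]: it belongs to the last step. *)
  exists N.-1; first by rewrite prednK.
  rewrite prednK// ger_pMl// t1 andbT; apply: le_trans l; rewrite ler_nat.
  by rewrite (leq_trans (leq_pred _)).
have mN1 : m%:R + 1 <= N%:R :> R by rewrite natr1 ler_nat.
have m0 : 0 <= m%:R :> R by [].
exists ((m%:R + 2^-1) / N%:R); split.
- by rewrite divr_ge0 ?ler_pdivrMr//; lra.
- rewrite -[t](mulfK (lt0r_neq0 NR)) -mulrBl normrM.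
  rewrite (gtr0_norm (_ : 0 < N%:R^-1)) ?invr_gt0// ger_pMl ?invr_gt0//.
  by move: tm; rewrite -natr1 ler_norml; lra.
move=> k kN; have [km|mk] := leqP k m; [right|left].
- rewrite -(ltr_pM2r NR) mulrDl !divfK ?gt_eqF//.
  have : k%:R <= m%:R :> R by rewrite ler_nat.
  lra.
- rewrite -(ltr_pM2r NR) mulrBl !divfK ?gt_eqF//.
  have : m%:R + 1 <= k%:R :> R by rewrite natr1 ler_nat.
  lra.
Qed.

End staircase.

(** * Vanishing of the little Lipschitz constant *)

Section little_lip.
Context {R : realType} {d : nat}.
Implicit Types (f g : Ccube R d).

(** The inner supremum is nonnegative, so only the bound from above on a
    sequence of scales tending to zero is at stake. *)
Lemma lip_eq0 f (x : cube R d) :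
  (forall e : R, 0 < e -> exists r : R, [/\ 0 < r, r < e &
     forall y : cube R d, `|\val x - \val y| <= r ->
       `|Cval f y - Cval f x| <= e * r]) ->
  lip f x = 0%E.
Proof.
move=> fx; rewrite /lip limf_einfE; apply/eqP; rewrite eq_le; apply/andP; split.
- apply: ge_ereal_sup => _ [V V0 <-]; apply/lee_addgt0Pr => e e0.
  rewrite add0e; have [c /= c0 cV] := V0.
  have [|r [r0 rec fr]] := fx (Num.min e c); first by rewrite lt_min e0.
  move: rec; rewrite lt_min => /andP[re rc].
  apply: (@le_trans _ _ (ereal_sup
    [set (`|Cval f y - Cval f x| / r)%:E
       | y in [set y : cube R d | `|\val x - \val y| <= r]])).
    apply: ereal_inf_lbound; exists r => //; apply: cV => //=.
    by rewrite sub0r normrN gtr0_norm.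
  apply: ge_ereal_sup => _ [y /= xy <-].
  rewrite lee_fin ler_pdivrMr//; apply: le_trans (fr y xy) _.
  by rewrite ler_pM2r// ge_min lexx.
- apply: (@le_trans _ _ (ereal_inf [set ereal_sup
    [set (`|Cval f y - Cval f x| / r)%:E
       | y in [set y : cube R d | `|\val x - \val y| <= r]]
    | r in [set r : R | 0 < r]])).
    apply: le_ereal_inf_tmp => _ [r /= r0 <-].
    apply: ereal_sup_ubound; exists x => /=; first by rewrite subrr normr0 ltW.
    by rewrite subrr normr0 mul0r.
  apply: ereal_sup_ubound; exists [set r : R | 0 < r] => //.
  exact: nbhs_right_gt.
Qed.

End little_lip.

(** * Terraced functions and their treads *)

Section terraces.
Context {R : realType} {d : nat}.
Implicit Types (x y : cube R d) (f g : Ccube R d) (N k n : nat) (r : R).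

(** The points whose coordinates all keep a distance more than [r] from the
    climbs of [staircase N r]. *)
Definition tread N r : set (cube R d) :=
  [set x : cube R d | forall (i : 'I_d) k, (k < N)%N ->
     \val x ord0 i < k%:R / N%:R - r \/ k%:R / N%:R + 2 * r < \val x ord0 i].

Definition slab N r (i : 'I_d) k : 'rV[R]_d * 'rV[R]_d :=
  (\row_j if j == i then k%:R / N%:R - r else 0,
   \row_j if j == i then k%:R / N%:R + 2 * r else 1).

Definition slabs N r : seq ('rV[R]_d * 'rV[R]_d) :=
  [seq slab N r i k | i <- enum 'I_d, k <- iota 0 N].

Definition terraced N r g :=
  forall x y, tread N r x -> `|\val x - \val y| <= r -> Cval g y = Cval g x.

(** Stage [n] asks for steps of length at most [1 / (n + 1)], so that treads come
    close to every point, for scales [r] that tend to zero as [n] grows, and for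
    slabs of total volume at most [1 / 2 ^ (n + 1)], a summable bound.  The fourth
    condition leaves room for flat parts between the climbs. *)
Definition fine_scale n N r :=
  [/\ (0 < N)%N /\ N%:R^-1 <= n.+1%:R^-1 :> R, 0 < r, r <= n.+1%:R^-1,
      4 * r * N%:R < 1 & 3 * r * (d * N)%:R <= (2 ^ n.+1)%:R^-1].

Lemma open_tread N r : open (tread N r).
Proof.
rewrite openE => x xN; rewrite /interior.
pose C (i : 'I_d) (k : 'I_N) (y : cube R d) :=
  \val y ord0 i < k%:R / N%:R - r \/ k%:R / N%:R + 2 * r < \val y ord0 i.
suff H : nbhs x [set y | forall i (k : 'I_N), C i k y].
  by apply: filterS H => y yN i k kN; exact: (yN i (Ordinal kN)).
apply: (@filter_forall _ _
  (fun i y => forall k : 'I_N, C i k y) (nbhs x) _) => i.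
apply: (@filter_forall _ _ (C i) (nbhs x) _) => k.
have coord y (e : R) : ball x e y -> `|\val x ord0 i - \val y ord0 i| < e.
  move=> /cube_ballP; apply: le_lt_trans.
  have /(row_norm_leP _ (normr_ge0 _))/(_ i) := lexx `|\val x - \val y|.
  by rewrite !mxE.
apply/nbhs_ballP; case: (xN i k (ltn_ord k)) => xk.
- exists (k%:R / N%:R - r - \val x ord0 i) => /= [|y /coord].
    by rewrite subr_gt0.
  by rewrite ltr_norml => ?; left; lra.
- exists (\val x ord0 i - (k%:R / N%:R + 2 * r)) => /= [|y /coord].
    by rewrite subr_gt0.
  by rewrite ltr_norml => ?; right; lra.
Qed.

Lemma near_tread N r x : (0 < N)%N -> 0 < r -> 4 * r * N%:R < 1 ->
  exists2 y, tread N r y & `|\val x - \val y| <= N%:R^-1.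
Proof.
move=> N0 r0 rN.
have [s sP] := choice (fun i => flat_point_near N0 r0 rN (cube_le x i)).
have sc : cube R d (\row_i s i) by move=> i; rewrite mxE; have [] := sP i.
exists (to_cube sc) => /=.
  by move=> i k kN /=; rewrite mxE; have [_ _] := sP i; exact.
apply/row_norm_leP => [|i]; first by rewrite invr_ge0.
by rewrite !mxE; have [] := sP i.
Qed.

Lemma slab_le N r i k : 0 < r -> forall j,
  (slab N r i k).1 ord0 j <= (slab N r i k).2 ord0 j.
Proof. by move=> r0 j; rewrite !mxE; case: eqP => // _; lra. Qed.

Lemma vol_slab N r i k : vol (slab N r i k).1 (slab N r i k).2 = 3 * r.
Proof.
rewrite /vol (bigD1 i)//= big1 => [|j ji]; rewrite !mxE ?(negbTE ji) ?subr0//.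
by rewrite eqxx mulr1; ring.
Qed.

Lemma vol_slabs N r : \sum_(p <- slabs N r) vol p.1 p.2 = 3 * r * (d * N)%:R.
Proof.
rewrite big_allpairs_dep/=.
under eq_bigr do under eq_bigr do rewrite vol_slab.
rewrite big_const_seq/= count_predT size_enum_ord.
rewrite big_const_seq/= count_predT size_iota !iter_addr_0.
by rewrite -!mulrnA mulr_natr mulnC.
Qed.

Lemma slabs_cover N r x : ~ tread N r x ->
  exists2 p, p \in slabs N r & box p.1 p.2 (\val x).
Proof.
move=> nx; have [i [k [kN /andP[xl xr]]]] : exists i k, (k < N)%N /\
    k%:R / N%:R - r <= \val x ord0 i <= k%:R / N%:R + 2 * r.
  apply: contrapT => H; apply: nx => i k kN.
  have [?|xl] := ltP (\val x ord0 i) (k%:R / N%:R - r); first by left.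
  have [?|xr] := ltP (k%:R / N%:R + 2 * r) (\val x ord0 i); first by right.
  by exfalso; apply: H; exists i, k; rewrite kN xl xr.
exists (slab N r i k); first by apply: allpairs_f; rewrite ?mem_enum ?mem_iota.
move=> j; rewrite !mxE; case: eqP => [->|_]; first by rewrite xl xr.
exact: cube_le.
Qed.

(** First [N] is taken large, and then [r] small in terms of [N]. *)
Lemma exists_fine_scale n (e : R) : 0 < e ->
  exists N r, fine_scale n N r /\ N%:R^-1 <= e.
Proof.
move=> e0; pose N := (Num.trunc (Num.max n.+1%:R e^-1)).+1.
have : Num.max n.+1%:R e^-1 < N%:R := truncnS_gt _.
rewrite gt_max => /andP[nN eN].
have N0 : 0 < N%:R :> R by rewrite ltr0n.
have H : \forall r \near (0:R)^'+, 0 < r /\ [/\ r < n.+1%:R^-1,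
    r < (4 * N%:R)^-1 & r < (2 ^ n.+1)%:R^-1 / (3 * (d * N).+1%:R)].
  apply: filterI; first exact: nbhs_right_gt.
  have P (c : R) : 0 < c -> \forall r \near (0:R)^'+, r < c.
    exact: nbhs_right_lt.
  near=> r; split; near: r; apply: P.
  - by rewrite invr_gt0.
  - by rewrite invr_gt0 mulr_gt0.
  - by rewrite divr_gt0 ?mulr_gt0// invr_gt0 ltr0n expn_gt0.
have [r [r0 [rn rN rd]]] := filter_ex H.
exists N, r; split; last by rewrite invf_ple ?posrE// ltW.
split => //.
- by split=> //; rewrite lef_pV2 ?posrE// ltW.
- exact: ltW.
- move: rN; rewrite -[_^-1]mul1r ltr_pdivlMr ?mulr_gt0//.
  by apply: le_lt_trans; lra.
- move: rd; rewrite ltr_pdivlMr ?mulr_gt0// => /ltW; apply: le_trans.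
  by rewrite mulrCA mulrA ler_pM2l ?mulr_gt0// ler_nat.
Unshelve. all: by end_near. Qed.

(** The function [f] is composed with the staircase in every coordinate. *)
Lemma exists_terraced f n (e : R) : 0 < e ->
  exists N r, fine_scale n N r /\ exists2 g, terraced N r g & supdist g f <= e.
Proof.
move=> e0; have [c c0 fc] := Ccube_unif_continuous f e0.
have [N [r [finer Nc]]] := exists_fine_scale n c0.
exists N, r; split => //.
have [[N0 _] r0 _ rN _] := finer.
have rN' : r <= N%:R^-1.
  by rewrite -[_^-1]mul1r ler_pdivlMr ?ltr0n//; move: rN; rewrite -mulrA; nra.
have st i x := staircase_dist N0 r0 rN' (cube_le x i).
have stc x : cube R d (\row_i staircase N r (\val x ord0 i)).
  move=> i; rewrite mxE; have := st i x; rewrite le_min => /and3P[xs -> _].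
  by rewrite andbT (le_trans _ xs)//; have /andP[] := cube_le x i.
pose phi x := to_cube (stc x).
have phiL x y : `|\val (phi x) - \val (phi y)| <= r^-1 * `|\val x - \val y|.
  apply/row_norm_leP => [|i]; first by rewrite mulr_ge0// invr_ge0 ltW.
  rewrite !mxE; apply: le_trans (staircase_Lipschitz _ _ N0 r0) _.
  rewrite ler_pM2l ?invr_gt0//.
  have /(row_norm_leP _ (normr_ge0 _))/(_ i) := lexx `|\val x - \val y|.
  by rewrite !mxE.
have r'0 : 0 < r^-1 by rewrite invr_gt0.
pose g : Ccube R d := mkcts (Lipschitz_comp_continuous (f := f) r'0 phiL).
have gE x : Cval g x = Cval f (phi x) by [].
exists g.
  move=> x y xN xy; rewrite !gE; congr (Cval f _); apply: val_inj => /=.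
  apply/rowP => i; rewrite !mxE; apply/esym.
  apply: staircase_flat (xN i) _ => //.
  by move: xy => /(row_norm_leP _ (ltW r0))/(_ i); rewrite !mxE.
apply: supdist_le => x; rewrite gE; apply/ltW/fc.
apply/row_norm_leP => [|i]; first exact: ltW.
rewrite !mxE; have := st i x; rewrite le_min ler_norml => /and3P[? ? ?].
by apply/andP; split; lra.
Qed.

(** The tolerance is relative to the scale [r] on which [g] is flat, so that it
    survives the division by [r] in the oscillation quotient. *)
Definition nearly_terraced n : set (Ccube R d) :=
  [set f | exists N r, fine_scale n N r /\
     exists2 g, terraced N r g & supdist g f < r / (2 * n.+1%:R)].

Lemma open_nearly_terraced n : open (nearly_terraced n).
Proof.
rewrite openE => f [N [r [finer [g gN gf]]]].
apply/nbhs_ballP; exists (r / (2 * n.+1%:R) - supdist g f) => /=.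
  by rewrite subr_gt0.
move=> h fh; have {}fh : supdist f h < r / (2 * n.+1%:R) - supdist g f by [].
exists N, r; split => //; exists g => //.
by apply: le_lt_trans (supdist_triangle f _ _) _; rewrite -ltrBrDl.
Qed.

Lemma dense_nearly_terraced n : dense (nearly_terraced n).
Proof.
move=> O [f Of] oO.
have /nbhs_ballP[e /= e0 eO] : nbhs f O by exact: open_nbhs_nbhs.
have e2 : 0 < e / 2 by rewrite divr_gt0.
have [N [r [finer [g gN gf]]]] := exists_terraced f n e2.
exists g; split.
  by apply: eO; have : supdist f g < e by rewrite supdist_sym; lra.
exists N, r; split => //; exists g => //.
by have [_ r0 _ _ _] := finer; rewrite supdistxx divr_gt0.
Qed.

Lemma nearly_terraced_osc n N r f g x y : 0 < r ->
  terraced N r g -> supdist g f < r / (2 * n.+1%:R) ->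
  tread N r x -> `|\val x - \val y| <= r ->
  `|Cval f y - Cval f x| <= n.+1%:R^-1 * r.
Proof.
move=> r0 gN gf xN xy.
have := supdist_ge g f x; have := supdist_ge g f y.
rewrite (gN x y xN xy) => gy gx.
have -> : n.+1%:R^-1 * r = r / (2 * n.+1%:R) + r / (2 * n.+1%:R).
  by field; rewrite nat1r.
apply: le_trans (ler_distD (Cval g x) _ _) _.
by rewrite lerD// ltW// (le_lt_trans _ gf)// distrC.
Qed.

(** The tread of stage [n] meets every ball of radius more than [1 / (n + 1)]. *)
Lemma residual_limsup_tread (N : nat -> nat) (r : nat -> R) :
  (forall n, fine_scale n (N n) (r n)) ->
  residual (\bigcap_m \bigcup_(n >= m) tread (N n) (r n)).
Proof.
move=> fineNr; apply: residual_limsup_open => [n|m]; first exact: open_tread.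
move=> O [x Ox] oO.
have /nbhs_ballP[e /= e0 eO] : nbhs x O by exact: open_nbhs_nbhs.
have : \forall n \near \oo, (m <= n)%N /\ n.+1%:R^-1 < e.
  apply: filterI; first exact: nbhs_infty_ge.
  exact: (near_infty_natSinv_lt (PosNum e0)).
move=> /filter_ex[n [mn ne]].
have [[N0 Nn] r0 _ rN _] := fineNr n.
have [y yN xy] := near_tread x N0 r0 rN.
exists y; split; last by exists n.
by apply/eO/cube_ballP; rewrite (le_lt_trans xy)// (le_lt_trans Nn).
Qed.

(** A point of the cube outside the limsup misses the treads of all late stages,
    so it lies in a slab of some stage after any given [m]. *)
Lemma full_measure_limsup_tread (N : nat -> nat) (r : nat -> R) :
  (0 < d)%N -> (forall n, fine_scale n (N n) (r n)) ->
  full_measure (\bigcap_m \bigcup_(n >= m) tread (N n) (r n)).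
Proof.
move=> d0 fineNr; set A := bigcap _ _.
apply/eqP; rewrite eq_le lebesgue_outer_ge0 andbT.
apply/lee_addgt0Pr => e e0; rewrite add0e.
have [m me] : exists m, 1 / 2 ^+ m < e.
  by have /filter_ex := near_infty_natSinv_expn_lt (PosNum e0).
pose s n := slabs (N (m + n)) (r (m + n)).
apply: le_trans (lebesgue_outer_le_boxes (s := s) d0 _ _) _.
- move=> n p /allpairsP[[i k] [_ _ ->]] j /=.
  by apply: slab_le; have [] := fineNr (m + n).
- move=> u [hu nu]; pose x := to_cube hu.
  have /existsNP[m0 nx] : ~ A x.
    by move=> Ax; apply: nu; exists x.
  have nt : ~ tread (N (m + m0)) (r (m + m0)) x.
    by move=> xt; apply: nx => _; exists (m + m0)%N => //=; rewrite leq_addl.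
  by exists m0; exact: slabs_cover nt.
- apply: (@le_trans _ _ (\sum_(n <oo) ((1 / 2 ^+ m) / (2 ^ n.+1)%:R)%:E)%E).
    apply: lee_nneseries => [n _ _|n _].
      by rewrite lee_fin vol_slabs !mulr_ge0//; have [_ /ltW] := fineNr (m + n).
    rewrite lee_fin vol_slabs mul1r -natrX -invfM -natrM -expnD addnS.
    by have [] := fineNr (m + n).
  apply: (le_trans (epsilon_trick0 _ _)); first by rewrite divr_ge0// exprn_ge0.
  by rewrite lee_fin ltW.
Qed.

End terraces.

Theorem theorem4p2 (R : realType) (d : nat) (d_gt0 : (0 < d)%N) :
  typical (fun f : Ccube R d =>
    exists A : set (cube R d),
      [/\ residual A, full_measure A & forall x, A x -> lip f x = 0%E]).
Proof.
apply: (residual_bigcap_open_dense open_nearly_terraced dense_nearly_terraced).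
move=> f fW.
have /choice[Nr NrP] : forall n, exists Nr : nat * R,
    @fine_scale R d n Nr.1 Nr.2 /\
    exists2 g, terraced Nr.1 Nr.2 g & supdist g f < Nr.2 / (2 * n.+1%:R).
  by move=> n; have [N [r H]] := fW n I; exists (N, r).
have fineNr n : @fine_scale R d n (Nr n).1 (Nr n).2 by have [] := NrP n.
exists (\bigcap_m \bigcup_(n >= m) tread (Nr n).1 (Nr n).2); split.
- exact: residual_limsup_tread fineNr.
- exact: full_measure_limsup_tread d_gt0 fineNr.
- move=> x Ax; apply: lip_eq0 => e e0.
  have [m me] : exists m, m.+1%:R^-1 < e.
    by have /filter_ex := near_infty_natSinv_lt (PosNum e0).
  have [n mn xn] := Ax m I.
  have ne : n.+1%:R^-1 < e.
    by apply: le_lt_trans me; rewrite lef_pV2 ?posrE// ler_nat.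
  have [[_ r0 rn _ _] [g gN gf]] := NrP n.
  exists (Nr n).2; split; [by []|exact: le_lt_trans ne|move=> y xy].
  apply: le_trans (nearly_terraced_osc r0 gN gf xn xy) _.
  by rewrite ler_pM2r// ltW.
Qed.
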